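(* Suppose that the loss satisfies the following exponential tail assumption: for all $z\in\mathcal{Z}$, there are some $G>0$ and $C>2$ such that $\mathbb{P}(|\ell(z,\eta)|>a)\le G\exp(-a\alpha C)$ for all $a\ge0$. Suppose also that the fitted distributions $(\mathbb{Q}_N)_{N}$ satisfy the following uniform exponential tail assumption: with probability one (with respect to the sampling process and the fitting procedure) there exist $G>0$, $C>2$ and $\bar N>0$ such that for all $N\ge\bar N$, $\mathbb{P}_{\mathbb{Q}_N}(|\zeta|>a)\le G\exp(-a\alpha C)$ for all $a\ge0$. Then for every $z\in\mathcal{Z}$ the estimator $\rho_{\hat{\mathbb{P}}_N}(\ell(z,\eta))+\delta_N(\mathbb{Q}_N)$ is strongly asymptotically consistent with respect to $\rho_{\mathbb{P}}(\ell(z,\eta))$; that is, almost surely, $$\rho_{\hat{\mathbb{P}}_N}(\ell(z,\eta))+\delta_N(\mathbb{Q}_N)\to\rho_{\mathbb{P}}(\ell(z,\eta))\quad\text{as }N\to\infty.$$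
   Context: Fix $\alpha>0$. $\mathcal{Z}\subseteq\mathbb{R}^d$ is a set of decisions, $\eta$ is a random vector with law $\mathbb{P}$, and $\ell(z,\eta)$ is a real random loss for each $z\in\mathcal{Z}$. For a distribution $\mathbb{Q}$, $\rho_{\mathbb{Q}}(X)=\frac1\alpha\log\mathbb{E}_{\mathbb{Q}}[\exp(\alpha X)]$ is the entropic risk. $\hat\eta_1,\hat\eta_2,\dots$ are i.i.d. from $\mathbb{P}$ and $\hat{\mathbb{P}}_N$ is the empirical distribution of the first $N$ of them, so $\rho_{\hat{\mathbb{P}}_N}(\ell(z,\eta))=\frac1\alpha\log(\frac1N\sum_{i=1}^N\exp(\alpha\ell(z,\hat\eta_i)))$. For each $N$, $\mathbb{Q}_N$ is a (random) probability distribution on $\mathbb{R}$ produced by some fitting procedure from the loss scenarios $\{\ell(z,\hat\eta_i)\}_{i=1}^N$. Given $\mathbb{Q}_N$, let $\zeta\sim\mathbb{Q}_N$ and let $\hat{\mathbb{Q}}_{N,N}$ be the empirical distribution of $N$ i.i.d. draws from $\mathbb{Q}_N$. The bias correction is $$\delta_N(\mathbb{Q}_N):=\mathrm{median}\big(\rho_{\mathbb{Q}_N}(\zeta)-\rho_{\hat{\mathbb{Q}}_{N,N}}(\zeta)\,\big|\,\mathbb{Q}_N\big),$$ the (conditional) median being with respect to the draws producing $\hat{\mathbb{Q}}_{N,N}$. *)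

(* Defs.v *)
From HB Require Import structures.
From mathcomp Require Import all_boot all_order all_algebra finmap.
From mathcomp Require Import all_classical all_reals all_analysis measurable_realfun.

Set Implicit Arguments.
Unset Strict Implicit.
Unset Printing Implicit Defensive.
Import Order.TTheory GRing.Theory Num.Theory.
Import numFieldNormedType.Exports.

Local Open Scope classical_set_scope.
Local Open Scope ring_scope.

(* The measure is not required to be a probability only so that the empirical
   measure of zero observations is covered. The value is in [\bar R] because
   the exponential moment may be infinite. *)
Definition entropic_risk d (T : measurableType d) (R : realType) (alpha : R)
    (mu : {measure set T -> \bar R}) (X : T -> R) : \bar R :=
  ((alpha^-1)%:E * lne (\int[mu]_x (expR (alpha * X x))%:E))%E.

Definition exp_tail d (T : measurableType d) (R : realType) (alpha G C : R)
    (mu : {measure set T -> \bar R}) (X : T -> R) : Prop :=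
  forall a : R, 0 <= a ->
    (mu [set x | (a < `|X x|)%R] <= (G * expR (- (a * alpha * C)))%:E)%E.

(* Empirical distribution of [x 0, ..., x N.-1]; it is the zero measure for
   [N = 0]. *)
Definition empirical d (T : measurableType d) (R : realType) (N : nat)
    (x : nat -> T) : {measure set T -> \bar R} :=
  mscale (N%:R^-1 : R)%:nng (msum (fun i => \d_(x i)) N).

Definition mutually_independent d d' (Omega : measurableType d)
    (T : measurableType d') (R : realType) (Pr : probability Omega R)
    (X : nat -> {mfun Omega >-> T}) : Prop :=
  forall (J : {fset nat}) (B : nat -> set T), (forall i, measurable (B i)) ->
    Pr (\bigcap_(i in [set` J]) (X i @^-1` B i)) =
    (\prod_(i <- J) Pr (X i @^-1` B i))%E.

(* The laws are compared on measurable sets only: a measure has arbitrary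
   values on the other sets. *)
Definition iid_sample d d' (Omega : measurableType d) (T : measurableType d')
    (R : realType) (Pr : probability Omega R) (P : probability T R)
    (X : nat -> {mfun Omega >-> T}) : Prop :=
  (forall i (B : set T), measurable B -> distribution Pr (X i) B = P B) /\
  mutually_independent Pr X.

Section iid_law.
Context d (T : measurableType d) (R : realType).

Definition tcons n (p : T * n.-tuple T) : n.+1.-tuple T :=
  [tuple of p.1 :: p.2].

Lemma measurable_tcons n : measurable_fun [set: T * n.-tuple T] (@tcons n).
Proof. exact: (measurable_cons measurable_fst measurable_snd). Qed.

HB.instance Definition _ n := isMeasurableFun.Build _ _ _ _ (@tcons n)
  (@measurable_tcons n).

(* Law of [n] independent draws from [Q], that is, the [n]-fold product of
   [Q]. *)
Fixpoint iid_law (Q : probability T R) (n : nat) : probability (n.-tuple T) R :=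
  match n with
  | 0 => \d_[tuple]
  | k.+1 => distribution (Q \x iid_law Q k)%E (@tcons k)
  end.

End iid_law.

(* A median need not be unique; [is_median mu X m] says that [m] is one. *)
Definition is_median d (T : measurableType d) (R : realType)
    (mu : {measure set T -> \bar R}) (X : T -> \bar R) (m : \bar R) : Prop :=
  ((2^-1)%:E <= mu [set x | X x <= m])%E /\
  ((2^-1)%:E <= mu [set x | m <= X x])%E.

(* Given [Q], the only randomness left is that of the [N] draws, so that the
   median conditional on [Q] is the median under [iid_law Q N]. The
   difference is [+oo] when [Q] has an infinite exponential moment. *)
Definition is_bias_correction (R : realType) (alpha : R) (N : nat)
    (Q : probability R R) (m : \bar R) : Prop :=
  is_median (iid_law Q N)
    (fun s => entropic_risk alpha Q idfun
              - entropic_risk alpha (empirical R N (nth 0%R s)) idfun)%E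
    m.

Definition scenarios (T : Type) (R : realType) (N : nat) (loss : T -> R)
    (x : nat -> T) : N.-tuple R :=
  [tuple loss (x i) | i < N].

(* Main.v *)
From HB Require Import structures.
Require Import Defs.
From mathcomp Require Import all_boot all_order all_algebra finmap.
From mathcomp Require Import all_classical all_reals all_analysis measurable_realfun.
From mathcomp Require Import ring lra.
Import Order.TTheory GRing.Theory Num.Theory.
Import numFieldNormedType.Exports.
Local Open Scope classical_set_scope.
Local Open Scope ring_scope.
Set Implicit Arguments.
Unset Strict Implicit.
Unset Printing Implicit Defensive.

(** The estimator is a sum of two terms with separate limits: the empirical
risk tends almost surely to the true risk, and the bias correction tends to
[0]. Both facts rest on the same observation: since [C > 2], the random
variable [expR (alpha * X)] has a second moment, bounded in terms of [alpha],
[G] and [C] alone, and a mean bounded away from [0]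
([exp_tail_moments]). So the mean of [N] pairwise independent copies has
variance at most [M / N] ([sample_sum_variance]).

For the empirical risk this gives the strong law of large numbers
([strong_law]). Along the squares the variances are summable, hence the
sample means converge almost surely along the squares; because the summands
are nonnegative, the partial sums are monotone, and this fills the gaps
between consecutive squares ([cvg_mean_of_squares]). Continuity of [ln]
concludes.

For the bias correction, fix an outcome for which the fitted laws have a
uniform exponential tail. Chebyshev's inequality under the law of the [N] draws
shows that the difference of the two risks exceeds [eps] in absolute value
with probability less than 1/2 as soon as [N] is large, uniformly over all laws
with that tail. A median has mass at least 1/2 on either side, so every
median lies within [eps] of [0] ([bias_correction_small]).

All integrands below are nonnegative, so that additivity and Tonelli's theorem
apply without integrability hypotheses: the variance bound, for instance,
comes from [(S - N mu)^2 + 2 N mu S = S^2 + (N mu)^2]. *)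

(** * Exponential moments under an exponential tail *)

Lemma measurable_ltr_set d (T : measurableType d) (R : realType)
    (f g : T -> R) :
  measurable_fun [set: T] f -> measurable_fun [set: T] g ->
  measurable [set x | f x < g x].
Proof.
move=> mf mg; rewrite -[X in measurable X]setTI.
by have := measurable_fun_ltr mf mg measurableT (Y := [set true]); exact.
Qed.

(** Markov's inequality for a set [E] on which [g] is at least [c], rather than
for a level set of [g]; it serves both for Chebyshev's bound and for bounding
an exponential moment from below. *)
Lemma markov_set d (T : measurableType d) (R : realType)
    (mu : {measure set T -> \bar R}) (E : set T) (g : T -> R) (c : R) :
  measurable E -> measurable_fun [set: T] g -> 0 <= c -> (forall x, 0 <= g x) ->
  (forall x, E x -> c <= g x) ->
  (c%:E * mu E <= \int[mu]_x (g x)%:E)%E.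
Proof.
move=> mE mg c0 g0 cg.
have -> : mu E = (\int[mu]_x (\1_E x)%:E)%E by rewrite integral_indic// setIT.
rewrite -ge0_integralZl//; last exact/measurable_EFinP.
apply: ge0_le_integral => //.
- by move=> x _; rewrite mule_ge0.
- by apply: measurable_funeM; exact/measurable_EFinP.
- exact/measurable_EFinP.
- move=> x _; rewrite -EFinM lee_fin indicE.
  have [xE|] := boolP (x \in E); last by rewrite mulr0.
  by rewrite mulr1 cg//; exact: set_mem.
Qed.

(** Slicing by [k < |X x| <= k + 1] bounds [expR (a * |X x|)] by
[1 + \sum_k expR (a * (k + 1)) * \1_(k < |X|)]; the [1] accounts for the points
where [X] vanishes. Under the tail assumption the expectation of the sum is at
most a geometric series of ratio [expR (a - b)]. *)
Lemma integral_expR_tail d (T : measurableType d) (R : realType)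
    (P : probability T R) (X : T -> R) (a G b : R) :
  0 < a -> a < b -> 0 <= G -> measurable_fun [set: T] X ->
  (forall t, 0 <= t ->
    (P [set x | (t < `|X x|)%R] <= (G * expR (- (t * b)))%:E)%E) ->
  (\int[P]_x (expR (a * `|X x|))%:E <=
    (1 + expR a * (G / (1 - expR (a - b))))%:E)%E.
Proof.
move=> a0 ab G0 mX tail.
pose A k := [set x | (k%:R < `|X x|)%R].
have mnX : measurable_fun [set: T] (fun x => `|X x|) by exact: measurableT_comp.
have mA k : measurable (A k) by exact: measurable_ltr_set.
pose u k x := ((expR a * expR (a * k%:R)) * \1_(A k) x)%:E : \bar R.
have u0 k x : (0 <= u k x)%E.
  by rewrite lee_fin !mulr_ge0// ?expR_ge0// indicE; case: (_ \in _).
have mu k : measurable_fun [set: T] (u k).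
  by apply/measurable_EFinP; apply: measurable_funM => //.
have ptw x : ((expR (a * `|X x|))%:E <= 1 + \sum_(0 <= k <oo) u k x)%E.
  have [X0|X0] := eqVneq (X x) 0.
    by rewrite X0 normr0 mulr0 expR0 leeDl// nneseries_ge0.
  have [k /andP[k1 k2]] : exists k : nat, (k%:R < `|X x| <= k.+1%:R)%R.
    have [n nX] : exists n, (fun n => `|X x| <= n%:R) n.
      by exists (Num.trunc `|X x|).+1; rewrite ltW// truncnS_gt.
    have ex : exists n, (fun n => `|X x| <= n%:R) n by exists n.
    case: (ex_minnP ex) => -[|k] kX kmin.
      by move: kX; rewrite normr_le0 (negbTE X0).
    exists k; rewrite kX andbT ltNge; apply/negP => /kmin.
    by rewrite ltnn.
  apply: (@le_trans _ _ (u k x)).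
    rewrite /u indicE mem_set// mulr1 lee_fin -expRD ler_expR.
    by rewrite -{2}(mulr1 a) -mulrDr ler_pM2l// addrC natr1.
  apply: (@le_trans _ _ (\sum_(0 <= k <oo) u k x)%E); last first.
    by rewrite leeDr.
  rewrite (@nneseriesD1 _ _ k)//.
    by rewrite leeDl// nneseries_ge0.
have mcst : measurable_fun [set: T] (fun x => (\sum_(0 <= k <oo) u k x)%E).
  apply: (@ge0_emeasurable_sum _ _ _ setT u predT) => k; first by move=> x _ _.
  by move=> _; exact: mu.
apply: (@le_trans _ _ (\int[P]_x (1 + \sum_(0 <= k <oo) u k x))%E).
  apply: ge0_le_integral => //.
  - apply/measurable_EFinP; apply: (measurableT_comp (@measurable_expR R)).
    exact: (measurable_funM (measurable_cst _) mnX).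
  - exact: emeasurable_funD.
rewrite ge0_integralD//; last by move=> *; rewrite nneseries_ge0.
rewrite integral_cst// mul1e [X in (X + _)%E](_ : _ = 1%E);
  last exact: probability_setT.
rewrite EFinD leeD2l// integral_nneseries//.
have i k : (\int[P]_x u k x <=
    (geometric (expR a * G) (expR (a - b)) k)%:E)%E.
  rewrite /u; under eq_integral do rewrite EFinM.
  rewrite ge0_integralZl//; last exact/measurable_EFinP.
  rewrite integral_indic// setIT.
  apply: (@le_trans _ _ ((expR a * expR (a * k%:R))%:E *
     (G * expR (- (k%:R * b)))%:E)%E).
    by rewrite lee_pmul2l// ?tail// lte_fin mulr_gt0// expR_gt0.
  rewrite -EFinM lee_fin /geometric/= -expRM_natr.
  have -> : expR ((a - b) * k%:R) = expR (a * k%:R) * expR (- (k%:R * b)).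
    by rewrite -expRD; congr expR; ring.
  by rewrite [leLHS](_ : _ =
    expR a * G * (expR (a * k%:R) * expR (- (k%:R * b))))//; ring.
apply: (@le_trans _ _ (\sum_(0 <= k <oo)
   (geometric (expR a * G) (expR (a - b)) k)%:E)%E).
  by apply: lee_nneseries => // k _; rewrite integral_ge0.
apply: lime_le.
  apply: is_cvg_nneseries => k _ _.
  by rewrite lee_fin /geometric/= mulr_ge0// ?exprn_ge0 ?mulr_ge0// expR_ge0.
apply: nearW => n; rewrite sumEFin lee_fin.
have := @geometric_le_lim R n (expR a * G) (expR (a - b)).
rewrite mulrA; apply.
- by rewrite mulr_ge0// expR_ge0.
- exact: expR_gt0.
- by rewrite ger0_norm ?expR_ge0// expR_lt1; lra.
Qed.

(** The bounds depend on [alpha], [G] and [C] only, hence hold simultaneously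
for all fitted laws. The second moment is finite because [expR (alpha * X) ^+ 2]
is [expR (2 * alpha * X)] and [2 * alpha < alpha * C]; the mean is bounded below
because [X >= - t] has probability at least 1/2 for a suitable [t]. *)
Lemma exp_tail_moments (R : realType) (alpha G C : R) :
  0 < alpha -> 0 < G -> 2 < C ->
  exists mu0 M : R, 0 < mu0 /\
    forall d (T : measurableType d) (P : probability T R) (X : T -> R),
      measurable_fun [set: T] X -> exp_tail alpha G C P X ->
      exists mu : R,
        [/\ mu0 <= mu, (\int[P]_x (expR (alpha * X x))%:E = mu%:E)%E &
            (\int[P]_x (expR (alpha * X x) ^+ 2)%:E <= M%:E)%E].
Proof.
move=> alpha0 G0 C2.
have C0 : 0 < C by lra.
(* chosen so that the tail bound at [t] is [G / (2 G + 1) <= 1/2] *)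
pose t := ln (2 * G + 1) / (alpha * C).
have t0 : 0 <= t by rewrite divr_ge0 ?ln_ge0 ?mulr_ge0//; lra.
have tE : G * expR (- (t * alpha * C)) <= 2^-1.
  have -> : t * alpha * C = ln (2 * G + 1).
    by rewrite /t; field; rewrite !gt_eqF.
  rewrite expRN lnK ?posrE; last by lra.
  by rewrite ler_pdivrMr; lra.
exists (expR (- (alpha * t)) * 2^-1).
exists (1 + expR (2 * alpha) * (G / (1 - expR (2 * alpha - alpha * C)))).
split; first by rewrite mulr_gt0 ?expR_gt0// invr_gt0.
move=> d T P X mX tail.
pose f x := expR (alpha * X x).
have f0 x : 0 <= f x by exact: expR_ge0.
have mf : measurable_fun [set: T] f.
  by apply: (measurableT_comp (@measurable_expR R)); exact: measurable_funM.
have mnX : measurable_fun [set: T] (fun x => `|X x|) by exact: measurableT_comp.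
have H2 : (\int[P]_x (f x ^+ 2)%:E <=
  (1 + expR (2 * alpha) * (G / (1 - expR (2 * alpha - alpha * C))))%:E)%E.
  apply: le_trans (integral_expR_tail (a := 2 * alpha) (G := G)
    (b := alpha * C) _ _ _ mX _).
  - apply: ge0_le_integral => //.
    + by move=> x _; rewrite lee_fin sqr_ge0.
    + by apply/measurable_EFinP; exact: measurable_funX.
    + apply/measurable_EFinP; apply: (measurableT_comp (@measurable_expR R)).
      exact: measurable_funM.
    + move=> x _; rewrite lee_fin -expRM_natr ler_expR.
      rewrite mulrC mulrA ler_pM2l ?mulr_gt0//; exact: ler_norm.
  - by rewrite mulr_gt0.
  - by rewrite mulrC ltr_pM2l.
  - exact: ltW.
  - by move=> s s0; rewrite mulrA; exact: tail.
have fin : (\int[P]_x (f x)%:E < +oo)%E.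
  apply: (@le_lt_trans _ _ (\int[P]_x (1 + (f x ^+ 2)%:E))%E).
    apply: ge0_le_integral => //.
    - by move=> x _; rewrite lee_fin.
    - exact/measurable_EFinP.
    - apply: emeasurable_funD => //; apply/measurable_EFinP.
      exact: measurable_funX.
    - move=> x _; rewrite -EFinD lee_fin.
      by have := sqr_ge0 (f x - 2^-1); nra.
  rewrite ge0_integralD//; last 2 first.
  - by move=> x _; rewrite lee_fin sqr_ge0.
  - by apply/measurable_EFinP; exact: measurable_funX.
  rewrite integral_cst// mul1e [X in (X + _)%E](_ : _ = 1%E);
    last exact: probability_setT.
  by rewrite lte_add_pinfty ?ltry// (le_lt_trans H2)// ltry.
have f0E : (0 <= \int[P]_x (f x)%:E)%E.
  by apply: integral_ge0 => x _; rewrite lee_fin.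
exists (fine (\int[P]_x (f x)%:E)); split => //; last first.
  by rewrite fineK// ge0_fin_numE.
rewrite -lee_fin fineK ?ge0_fin_numE//.
pose E := [set x | t < `|X x|].
have mE : measurable E by exact: measurable_ltr_set.
have PE : (2^-1%:E <= P (~` E))%E.
  rewrite probability_setC// leeBrDr ?fin_num_measure//.
  apply: (@le_trans _ _ (2^-1%:E + 2^-1%:E)%E).
    by rewrite leeD2l// (le_trans (tail t t0))// lee_fin.
  by rewrite -EFinD lee_fin; lra.
apply: (@le_trans _ _ ((expR (- (alpha * t)))%:E * P (~` E))%E).
  by rewrite EFinM lee_wpmul2l// lee_fin expR_ge0.
apply: markov_set => //; first exact: measurableC.
move=> x /negP; rewrite -leNgt => Xt.
rewrite ler_expR -mulrN ler_pM2l// lerNl (le_trans _ Xt)//.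
by rewrite -normrN ler_norm.
Qed.

(** * Entropic risks as logarithms of means *)

Lemma entropic_risk_fin d (T : measurableType d) (R : realType) (alpha mu : R)
    (P : {measure set T -> \bar R}) (X : T -> R) :
  (\int[P]_x (expR (alpha * X x))%:E = mu%:E)%E -> 0 < mu ->
  entropic_risk alpha P X = (alpha^-1 * ln mu)%:E.
Proof. by move=> E mu0; rewrite /entropic_risk E lne_EFin. Qed.

Lemma entropic_risk_empirical d (T : measurableType d) (R : realType)
    (alpha : R) (N : nat) (x : nat -> T) (X : T -> R) :
  measurable_fun [set: T] X -> (0 < N)%N ->
  entropic_risk alpha (empirical R N x) X =
  (alpha^-1 * ln ((\sum_(i < N) expR (alpha * X (x i))) / N%:R))%:E.
Proof.
move=> mX N0.
have mE : measurable_fun [set: T] (fun t => (expR (alpha * X t))%:E).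
  apply/measurable_EFinP; apply: (measurableT_comp (@measurable_expR R)).
  exact: measurable_funM.
have E0 t : [set: T] t -> (0 <= (expR (alpha * X t))%:E)%E.
  by rewrite lee_fin expR_ge0.
apply: entropic_risk_fin; last first.
  rewrite divr_gt0 ?ltr0n//; case: N N0 => // N _.
  rewrite big_ord_recl; apply: ltr_pwDl; first exact: expR_gt0.
  by apply: sumr_ge0 => i _; exact: expR_ge0.
rewrite ge0_integral_mscale// ge0_integral_measure_sum//.
under eq_bigr do rewrite integral_dirac// diracT mul1e.
by rewrite sumEFin -EFinM mulrC.
Qed.

(** * Variance of a sum of pairwise independent variables *)

Section pairwise_iid.
Context d d' (Omega : measurableType d) (T : measurableType d') (R : realType).
Variables (Pr : probability Omega R) (P : probability T R).

(** Only indices below [N] are constrained, so that the notion covers both an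
infinite sample and the [N] coordinates of an [N]-tuple. *)
Definition pairwise_iid N (X : nat -> {mfun Omega >-> T}) : Prop :=
  (forall i A, (i < N)%N -> measurable A -> Pr (X i @^-1` A) = P A) /\
  (forall i j A B, (i < N)%N -> (j < N)%N -> i != j ->
    measurable A -> measurable B ->
    Pr (X i @^-1` A `&` X j @^-1` B) = (P A * P B)%E).

Lemma ge0_integral_law (X : {mfun Omega >-> T}) (f : T -> \bar R) :
  (forall A, measurable A -> Pr (X @^-1` A) = P A) ->
  measurable_fun [set: T] f -> (forall t, 0 <= f t)%E ->
  (\int[Pr]_w f (X w) = \int[P]_t f t)%E.
Proof.
move=> XP mf f0; rewrite -(ge0_integral_distribution X mf f0).
by apply: eq_measure_integral => A mA _; exact: XP.
Qed.

(** The joint law of [X] and [Y] agrees with the product measure on rectangles,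
hence everywhere, and Tonelli's theorem factors the integral. *)
Lemma ge0_integral_mul_indep (X Y : {mfun Omega >-> T}) (f : T -> R) :
  (forall A B, measurable A -> measurable B ->
    Pr (X @^-1` A `&` Y @^-1` B) = (P A * P B)%E) ->
  measurable_fun [set: T] f -> (forall t, 0 <= f t) ->
  (\int[Pr]_w (f (X w) * f (Y w))%:E =
   \int[P]_t (f t)%:E * \int[P]_t (f t)%:E)%E.
Proof.
move=> XYP mf f0.
pose Z w := (X w, Y w).
have mZ : measurable_fun [set: Omega] Z by exact: measurable_fun_pair.
pose Zm : {mfun Omega >-> (T * T)%type} :=
  HB.pack Z (isMeasurableFun.Build _ _ _ _ Z mZ).
pose F (p : T * T) := (f p.1 * f p.2)%:E.
have mF : measurable_fun [set: T * T] F.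
  by apply/measurable_EFinP; apply: measurable_funM;
    [exact: (measurableT_comp mf measurable_fst)
    |exact: (measurableT_comp mf measurable_snd)].
have F0 p : (0 <= F p)%E by rewrite lee_fin mulr_ge0.
have mfE : measurable_fun [set: T] (fun t => (f t)%:E).
  exact/measurable_EFinP.
have I0 : (0 <= \int[P]_t (f t)%:E)%E.
  by apply: integral_ge0 => t _; rewrite lee_fin.
transitivity (\int[distribution Pr Zm]_p F p)%E.
  by rewrite (ge0_integral_distribution Zm mF F0).
transitivity (\int[(P \x P)%E]_p F p)%E.
  apply: eq_measure_integral => A mA _; apply/esym.
  by apply: product_measure_unique => // B C mB mC; rewrite -XYP.
rewrite fubini_tonelli1// /fubini_F/= /F/=.
transitivity (\int[P]_x ((f x)%:E * \int[P]_t (f t)%:E))%E.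
  apply: eq_integral => x _; rewrite -ge0_integralZl ?lee_fin// => t _.
  by rewrite lee_fin.
by rewrite ge0_integralZr// => t _; rewrite lee_fin.
Qed.

(** Writing [S] for the sum, [E[S^2]] has [N] diagonal terms, each at most [M],
and at most [N^2] terms equal to [mu^2]. Integrating
[(S - N mu)^2 + 2 N mu S = S^2 + (N mu)^2], whose terms are nonnegative, then
leaves [N M]. *)
Lemma sample_sum_variance N (X : nat -> {mfun Omega >-> T}) (f : T -> R)
    (mu M : R) :
  pairwise_iid N X ->
  measurable_fun [set: T] f -> (forall t, 0 <= f t) ->
  (\int[P]_t (f t)%:E = mu%:E)%E ->
  (\int[P]_t (f t ^+ 2)%:E <= M%:E)%E ->
  (\int[Pr]_w ((\sum_(i < N) f (X i w) - N%:R * mu) ^+ 2)%:E <=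
    (N%:R * M)%:E)%E.
Proof.
move=> [law indep] mf f0 muE ME.
have mu0 : 0 <= mu.
  by rewrite -lee_fin -muE integral_ge0// => t _; rewrite lee_fin.
have M0 : 0 <= M.
  rewrite -lee_fin; apply: le_trans ME; apply: integral_ge0 => t _.
  by rewrite lee_fin sqr_ge0.
pose S w := \sum_(i < N) f (X i w).
have mfX i : measurable_fun [set: Omega] (fun w => f (X i w)).
  exact: measurableT_comp.
have mS : measurable_fun [set: Omega] S by exact: measurable_sum.
have S0 w : 0 <= S w by apply: sumr_ge0.
have ES : (\int[Pr]_w (S w)%:E = (N%:R * mu)%:E)%E.
  rewrite /S; under eq_integral do rewrite -sumEFin.
  rewrite ge0_integral_sum//; last 2 first.
  - by move=> i; exact/measurable_EFinP.
  - by move=> i w _; rewrite lee_fin.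
  rewrite (eq_bigr (fun=> mu%:E)); last first.
    move=> i _; rewrite -muE.
    apply: (@ge0_integral_law (X i) (fun t => (f t)%:E)) => //.
    - by move=> A mA; exact: law.
    - exact/measurable_EFinP.
  by rewrite sumEFin sumr_const card_ord mulr_natl.
have ES2 : (\int[Pr]_w (S w ^+ 2)%:E <=
    (N%:R * M + (N%:R * mu) ^+ 2)%:E)%E.
  have S2 w : (S w ^+ 2)%:E =
      (\sum_(i < N) \sum_(j < N) (f (X i w) * f (X j w))%:E)%E.
    rewrite expr2 /S mulr_suml -sumEFin; apply: eq_bigr => i _.
    by rewrite mulr_sumr -sumEFin.
  under eq_integral do rewrite S2.
  have mff i j : measurable_fun [set: Omega]
      (fun w => (f (X i w) * f (X j w))%:E).
    by apply/measurable_EFinP; exact: measurable_funM.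
  rewrite ge0_integral_sum//; last 2 first.
  - by move=> i; exact: emeasurable_sum.
  - by move=> i w _; rewrite sume_ge0// => j _; rewrite lee_fin mulr_ge0.
  (* the diagonal also receives [mu ^+ 2], which makes the total exactly
     [N * M + (N * mu) ^+ 2] *)
  apply: (@le_trans _ _ (\sum_(i < N) \sum_(j < N)
      ((i == j)%:R * M + mu ^+ 2)%:E)%E).
    apply: lee_sum => i _; rewrite ge0_integral_sum//; last first.
      by move=> j w _; rewrite lee_fin mulr_ge0.
    apply: lee_sum => j _; have [->|ij] := eqVneq i j.
      rewrite mul1r -[leLHS]/(\int[Pr]_w (fun t => (f t ^+ 2)%:E) (X j w))%E.
      rewrite ge0_integral_law//; last 3 first.
      - by move=> A mA; exact: law.
      - by apply/measurable_EFinP; exact: measurable_funX.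
      - by move=> t; rewrite lee_fin sqr_ge0.
      by apply: (le_trans ME); rewrite lee_fin lerDl sqr_ge0.
    rewrite mul0r add0r ge0_integral_mul_indep//.
      by rewrite muE -EFinM expr2.
    by move=> A B mA mB; exact: indep.
  under eq_bigr do rewrite sumEFin.
  rewrite sumEFin lee_fin (eq_bigr (fun=> M + N%:R * mu ^+ 2)).
    rewrite sumr_const card_ord -[(M + _) *+ N]mulr_natl.
    by rewrite [leLHS](_ : _ = N%:R * M + (N%:R * mu) ^+ 2)//; ring.
  move=> i _; rewrite big_split/= sumr_const card_ord -[_ ^+ 2 *+ N]mulr_natl.
  congr (_ + _); rewrite (bigD1 i)//= eqxx mul1r big1 ?addr0// => j ji.
  by rewrite eq_sym (negbTE ji) mul0r.
have mD : measurable_fun [set: Omega] (fun w => ((S w - N%:R * mu) ^+ 2)%:E).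
  apply/measurable_EFinP; apply: measurable_funX.
  exact: measurable_funB.
have c0 : 0 <= 2 * (N%:R * mu) by rewrite !mulr_ge0.
have : (\int[Pr]_w ((S w - N%:R * mu) ^+ 2)%:E
    + (2 * (N%:R * mu))%:E * (N%:R * mu)%:E
   = \int[Pr]_w (S w ^+ 2)%:E + ((N%:R * mu) ^+ 2)%:E)%E.
  rewrite -ES -ge0_integralZl//; last 2 first.
  - exact/measurable_EFinP.
  - by move=> w _; rewrite lee_fin.
  rewrite -ge0_integralD//; last 3 first.
  - by move=> w _; rewrite lee_fin sqr_ge0.
  - by move=> w _; rewrite -EFinM lee_fin mulr_ge0.
  - by apply: measurable_funeM; exact/measurable_EFinP.
  rewrite -[X in (_ + X)%E](_ :
      (\int[Pr]_w (cst ((N%:R * mu) ^+ 2)%:E) w)%E = _).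
    rewrite -ge0_integralD//; last 3 first.
    - by move=> w _; rewrite lee_fin sqr_ge0.
    - by apply/measurable_EFinP; exact: measurable_funX.
    - by move=> w _; rewrite lee_fin sqr_ge0.
    apply: eq_integral => w _; rewrite -EFinM -!EFinD; congr EFin.
    by rewrite /=; ring.
  rewrite integral_cst// [X in (_ * X)%E](_ : _ = 1%E) ?mule1//.
  exact: probability_setT.
move=> E.
have : (\int[Pr]_w ((S w - N%:R * mu) ^+ 2)%:E
    + (2 * (N%:R * mu) * (N%:R * mu))%:E
   <= (N%:R * M + (N%:R * mu) ^+ 2)%:E + ((N%:R * mu) ^+ 2)%:E)%E.
  by rewrite EFinM E leeD2r.
rewrite -EFinD -leeBrDr// -EFinB => /le_trans; apply.
by rewrite lee_fin [leLHS](_ : _ = N%:R * M)//; ring.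
Qed.

End pairwise_iid.

(** * Strong law of large numbers *)

Lemma square_bracket (N : nat) : exists n, (n ^ 2 <= N < n.+1 ^ 2)%N.
Proof.
have ex : exists n, (n ^ 2 <= N)%N by exists 0%N.
have bd n : (n ^ 2 <= N -> n <= N)%N.
  by apply: leq_trans; case: n => // n; rewrite leq_pmulr.
case: (ex_maxnP ex bd) => n nN nmax; exists n; rewrite nN/= ltnNge.
by apply/negP => /nmax; rewrite ltnn.
Qed.

(** For [(n + 1)^2 <= N < (n + 2)^2] monotonicity places [s N / N] between
[s ((n + 1)^2) / (n + 2)^2] and [s ((n + 2)^2) / (n + 1)^2]. Up to the factor
[((n + 1) / (n + 2))^2], which tends to [1], these are two consecutive terms
of the sequence along the squares. *)
Lemma cvg_mean_of_squares (R : realType) (s : nat -> R) (mu : R) :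
  nondecreasing_seq s -> (forall n, 0 <= s n) ->
  (fun n => s (n.+1 ^ 2)%N / (n.+1 ^ 2)%N%:R) @ \oo --> mu ->
  (fun n => s n / n%:R) @ \oo --> mu.
Proof.
move=> s_nd s0 sq.
pose a n : R := s (n.+1 ^ 2)%N / (n.+1 ^ 2)%N%:R.
have /choice[r rP] := square_bracket.
have ry : (fun N => (r N).-1) @ \oo --> \oo.
  apply/cvgnyPge => k; exists (k.+2 ^ 2)%N => // N /= kN.
  have /andP[_ rN] := rP N.
  have : (k.+2 < (r N).+1)%N.
    by rewrite -(@ltn_exp2r _ _ 2) ?(leq_ltn_trans kN).
  by case: (r N) => [|n]//=; rewrite !ltnS => /ltnW.
pose q (n : nat) : R := n.+1%:R / n.+2%:R.
have q1 : q @ \oo --> (1 : R).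
  have -> : q = (fun n => 1 - n.+2%:R^-1).
    apply/funext => n; rewrite /q.
    have n2 : n.+2%:R != 0 :> R by rewrite pnatr_eq0.
    apply: (mulIf n2); rewrite mulrBl mulVf// divfK// mul1r.
    by rewrite -[in RHS]natr1 addrK.
  rewrite -[X in _ --> X](subr0 1); apply: cvgB; first exact: cvg_cst.
  by have := @cvg_harmonic R; rewrite -cvg_shiftS.
have lo : (fun n => a n * (q n * q n)) @ \oo --> mu.
  rewrite -[X in _ --> X](mulr1 mu) -[X in _ * X](mulr1 1).
  by apply: cvgM => //; exact: cvgM.
have hi : (fun n => a n.+1 / (q n * q n)) @ \oo --> mu.
  rewrite -[X in _ --> X](mulr1 mu) -[X in _ * X](divr1 1) -{2}(mulr1 1).
  apply: cvgM; first by rewrite (cvg_shiftS a).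
  rewrite mul1r; apply: cvgV; last exact: cvgM.
  by rewrite mulr1 oner_neq0.
have sc (x y c : R) : x != 0 -> y != 0 ->
    c / x ^+ 2 * (x / y * (x / y)) = c / y ^+ 2.
  by move=> x0 y0; field; rewrite ?x0 ?y0.
have sc' (x y c : R) : x != 0 -> y != 0 ->
    c / y ^+ 2 / (x / y * (x / y)) = c / x ^+ 2.
  by move=> x0 y0; field; rewrite ?x0 ?y0.
(* [r N] is the integer square root of [N], hence the predecessor *)
apply: (@squeeze_cvgr _ _ _ _ (fun N => a (r N).-1 * (q (r N).-1 * q (r N).-1))
   (fun N => a (r N).-1.+1 / (q (r N).-1 * q (r N).-1))).
- exists 1%N => // N /= N1.
  have := rP N; case: (r N) => [|n] /andP[nN Nn] /=.
    by move: Nn; rewrite ltnS leqn0 => /eqP N0; rewrite N0 in N1.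
  have N0 : 0 < N%:R :> R by rewrite ltr0n.
  have H1 : s (n.+1 ^ 2)%N <= s N by exact: s_nd.
  have H2 : s N <= s (n.+2 ^ 2)%N by exact/s_nd/ltnW.
  have E1 : a n * (q n * q n) = s (n.+1 ^ 2)%N / (n.+2 ^ 2)%N%:R.
    by rewrite /a /q !natrX; apply: sc; rewrite pnatr_eq0.
  have E2 : a n.+1 / (q n * q n) = s (n.+2 ^ 2)%N / (n.+1 ^ 2)%N%:R.
    by rewrite /a /q !natrX; apply: sc'; rewrite pnatr_eq0.
  rewrite E1 E2; apply/andP; split.
    apply: ler_pM => //; rewrite ?invr_ge0//.
    by rewrite lef_pV2 ?posrE ?ltr0n ?expn_gt0// ler_nat ltnW.
  apply: ler_pM => //; rewrite ?invr_ge0//.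
  by rewrite lef_pV2 ?posrE ?ltr0n ?expn_gt0// ler_nat.
- exact: (cvg_comp _ _ ry lo).
- exact: (cvg_comp _ _ ry hi).
Qed.

Lemma sum_inv_squares_le (R : realType) (n : nat) :
  \sum_(0 <= k < n) ((k.+1 ^ 2)%N%:R : R)^-1 <= 2.
Proof.
(* the stronger bound is inductive, as [1 / x^2 <= 2 / x - 2 / (x + 1)] *)
suff : \sum_(0 <= k < n) ((k.+1 ^ 2)%N%:R : R)^-1 <= 2 - 2 / n.+1%:R.
  by move=> /le_trans; apply; rewrite gerBl divr_ge0.
elim: n => [|n ih]; first by rewrite big_nil divr1 subrr.
rewrite big_nat_recr//= natrX.
apply: (le_trans (lerD ih (lexx _))).
have x0 : 0 < n.+1%:R :> R by rewrite ltr0n.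
have x1 : 1 <= n.+1%:R :> R by rewrite ler1n.
rewrite -[n.+2%:R]natr1; move: (n.+1%:R : R) x0 x1 => x x0 x1.
rewrite -subr_ge0 [leRHS](_ : _ = (x - 1) / (x ^+ 2 * (x + 1))).
  by rewrite divr_ge0 ?subr_ge0// mulr_ge0 ?sqr_ge0 ?addr_ge0// ltW.
have x'0 : x + 1 != 0 by rewrite gt_eqF// addr_gt0.
by field; rewrite ?x'0 gt_eqF.
Qed.

(** A finite second moment makes the mean square errors along the squares
summable, so almost surely their sum converges and its terms tend to [0]. *)
Lemma strong_law d d' (Omega : measurableType d) (T : measurableType d')
    (R : realType) (Pr : probability Omega R) (P : probability T R)
    (X : nat -> {mfun Omega >-> T}) (f : T -> R) (mu M : R) :
  (forall N, pairwise_iid Pr P N X) ->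
  measurable_fun [set: T] f -> (forall t, 0 <= f t) ->
  (\int[P]_t (f t)%:E = mu%:E)%E ->
  (\int[P]_t (f t ^+ 2)%:E <= M%:E)%E ->
  {ae Pr, forall w,
    (fun N => (\sum_(i < N) f (X i w)) / N%:R) @ \oo --> mu}.
Proof.
move=> iidX mf f0 muE ME.
have M0 : 0 <= M.
  rewrite -lee_fin; apply: le_trans ME; apply: integral_ge0 => t _.
  by rewrite lee_fin sqr_ge0.
pose S N w := \sum_(i < N) f (X i w).
have mS N : measurable_fun [set: Omega] (S N).
  by apply: measurable_sum => i; exact: measurableT_comp.
pose K n := (n.+1 ^ 2)%N.
have K0 n : 0 < (K n)%:R :> R by rewrite ltr0n expn_gt0.
pose D n w := (S (K n) w / (K n)%:R - mu) ^+ 2.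
have mD n : measurable_fun [set: Omega] (fun w => (D n w)%:E).
  apply/measurable_EFinP; apply: measurable_funX; apply: measurable_funB => //.
  exact: measurable_funM.
have D0 n w : (0 <= (D n w)%:E)%E by rewrite lee_fin sqr_ge0.
have ID n : (\int[Pr]_w (D n w)%:E <= (M * ((K n)%:R)^-1)%:E)%E.
  have DE w : (D n w)%:E =
      (((K n)%:R^-1 ^+ 2)%:E * ((S (K n) w - (K n)%:R * mu) ^+ 2)%:E)%E.
    rewrite -EFinM /D -exprMn; congr ((_ ^+ 2)%:E).
    by rewrite mulrBr mulrA mulVf ?gt_eqF// mul1r mulrC.
  under eq_integral do rewrite DE.
  rewrite ge0_integralZl//; last 2 first.
  - apply/measurable_EFinP; apply: measurable_funX.
    exact: measurable_funB.
  - by move=> w _; rewrite lee_fin sqr_ge0.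
  apply: le_trans.
    apply: lee_wpmul2l; first by rewrite lee_fin sqr_ge0.
    exact: (sample_sum_variance (iidX (K n)) mf f0 muE ME).
  rewrite -EFinM lee_fin [leLHS](_ : _ = M * (K n)%:R^-1)//.
  by move: (K0 n); move: ((K n)%:R : R) => x x0; field; rewrite gt_eqF.
have SD : (\int[Pr]_w (\sum_(0 <= n <oo) (D n w)%:E) < +oo)%E.
  rewrite integral_nneseries//.
  apply: (@le_lt_trans _ _ (M * 2)%:E); last exact: ltry.
  apply: lime_le.
    by apply: is_cvg_nneseries => n _ _; apply: integral_ge0.
  apply: nearW => n.
  apply: (@le_trans _ _ (\sum_(0 <= k < n) (M * (K k)%:R^-1)%:E)%E).
    by apply: lee_sum => k _; exact: ID.
  by rewrite sumEFin lee_fin -mulr_sumr ler_wpM2l// sum_inv_squares_le.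
have mSD : measurable_fun [set: Omega]
    (fun w => (\sum_(0 <= n <oo) (D n w)%:E)%E).
  apply: (@ge0_emeasurable_sum _ _ _ setT (fun n w => (D n w)%:E) predT) => k.
    by move=> x _ _; exact: D0.
  by move=> _; exact: mD.
have iSD : Pr.-integrable [set: Omega]
    (fun w => (\sum_(0 <= n <oo) (D n w)%:E)%E).
  apply/integrableP; split => //.
  under eq_integral do rewrite gee0_abs ?nneseries_ge0//.
  exact: SD.
apply: filterS (integrable_ae measurableT iSD) => w /(_ I) fin.
apply: (@cvg_mean_of_squares R (fun N => S N w)).
- move=> n k nk; rewrite /S -!(big_mkord xpredT (fun i => f (X i w))).
  by rewrite (big_cat_nat _ nk)//= lerDl sumr_ge0.
- by move=> n; apply: sumr_ge0.
have D0' : (fun n => D n w) @ \oo --> 0.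
  apply: cvg_series_cvg_0; apply: nnseries_is_cvg => [n|].
    exact: sqr_ge0.
  by rewrite ltey_eq fin.
apply/cvgrPdist_lt => e e0.
move/cvgrPdist_lt : D0' => /(_ _ (exprn_gt0 2 e0)).
apply: filterS => n /=; rewrite sub0r normrN ger0_norm ?sqr_ge0//.
move=> De; rewrite distrC -(@ltr_pXn2r _ 2) ?nnegrE ?(ltW e0)//.
by rewrite real_normK ?num_real.
Qed.

(** * Pairwise independence of the two kinds of samples *)

Section iid_law_coordinates.
Context d (T : measurableType d) (R : realType).
Variables (Q : probability T R) (x0 : T).

(** The default value [x0] makes [draw] total in [i], so that the coordinates
form a sequence of random variables like any other sample. *)
Definition draw N i (s : N.-tuple T) : T := nth x0 s i.

Lemma measurable_draw N i : measurable_fun [set: N.-tuple T] (@draw N i).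
Proof.
have [iN|Ni] := ltnP i N; last first.
  rewrite (_ : @draw N i = cst x0); first exact: measurable_cst.
  by apply/funext => s; rewrite /draw nth_default// size_tuple.
rewrite (_ : @draw N i = (fun s => tnth s (Ordinal iN))).
  exact: measurable_tnth.
by apply/funext => s; rewrite /draw (tnth_nth x0).
Qed.

HB.instance Definition _ N i :=
  isMeasurableFun.Build _ _ _ _ (@draw N i) (@measurable_draw N i).

(** The product structure of [iid_law] enters only through its values on boxes:
a box in [N + 1] coordinates is the product of its first side with a box in
[N] coordinates. *)
Lemma iid_law_box N (B : nat -> set T) : (forall i, measurable (B i)) ->
  iid_law Q N [set s | forall i, (i < N)%N -> B i (draw i s)] =
  (\prod_(i < N) Q (B i))%E.
Proof.
elim: N B => [|N ih] B mB.
  by rewrite big_ord0 /= diracE mem_set.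
rewrite big_ord_recl -(ih (fun i => B i.+1))//=.
have mbox : measurable
    [set s : N.-tuple T | forall i, (i < N)%N -> B i.+1 (draw i s)].
  rewrite (_ : [set s | _] =
      \bigcap_(i in [set i | (i < N)%N]) (@draw N i @^-1` B i.+1)).
    apply: bigcap_measurableType => i _; rewrite -[X in measurable X]setTI.
    exact: measurable_draw.
  by apply/seteqP; split => s /= h i; exact: h.
rewrite -product_measure1E//; congr (_ _).
apply/seteqP; split => [[x s] /= h|[x s] [/= xB sB]].
  by split=> [|i iN]; [exact: (h 0%N)|exact: (h i.+1)].
by case=> [|i] //= iN; exact: sB.
Qed.

(** The marginals are the measures of boxes whose remaining sides are the whole
space. *)
Lemma pairwise_iid_draw N : pairwise_iid (iid_law Q N) Q N (@draw N).
Proof.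
split=> [i A iN mA|i j A B iN jN ij mA mB].
  pose F k := if k == i then A else setT.
  have mF k : measurable (F k) by rewrite /F; case: ifP.
  transitivity (\prod_(k < N) Q (F k))%E.
    rewrite -iid_law_box//; congr (_ _).
    apply/seteqP; split => [s /= sA k kN|s /= h].
      by rewrite /F; case: eqP => // ->.
    by have := h i iN; rewrite /F eqxx.
  rewrite (bigD1 (Ordinal iN))//= big1 ?mule1.
    by rewrite /F eqxx.
  move=> k ki; rewrite /F -[_ == i]/(k == Ordinal iN) (negbTE ki).
  exact: probability_setT.
pose F k := if k == i then A else if k == j then B else setT.
have mF k : measurable (F k) by rewrite /F; case: ifP => //; case: ifP.
transitivity (\prod_(k < N) Q (F k))%E.
  rewrite -iid_law_box//; congr (_ _).
  apply/seteqP; split => [s /= [sA sB] k kN|s /= h].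
    by rewrite /F; case: eqP => [->//|_]; case: eqP => // ->.
  split; first by have := h i iN; rewrite /F eqxx.
  by have := h j jN; rewrite /F eq_sym (negbTE ij) eqxx.
rewrite (bigD1 (Ordinal iN))//= (bigD1 (Ordinal jN))/=; last first.
  by rewrite -val_eqE/= eq_sym.
rewrite big1 ?mule1.
  by rewrite /F !eqxx eq_sym (negbTE ij).
move=> k /andP[ki kj].
rewrite /F -[_ == i]/(k == Ordinal iN) -[_ == j]/(k == Ordinal jN).
rewrite (negbTE ki) (negbTE kj); exact: probability_setT.
Qed.

End iid_law_coordinates.

Lemma pairwise_iid_sample d d' (Omega : measurableType d)
    (T : measurableType d') (R : realType) (Pr : probability Omega R)
    (P : probability T R) (X : nat -> {mfun Omega >-> T}) N :
  iid_sample Pr P X -> pairwise_iid Pr P N X.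
Proof.
move=> [law indep]; split=> [i A _ mA|i j A B _ _ ij mA mB].
  exact: law.
pose F k := if k == i then A else B.
have mF k : measurable (F k) by rewrite /F; case: ifP.
have := indep [fset i; j]%fset F mF.
rewrite big_fsetU1/= ?inE// big_seq_fset1 /F eqxx eq_sym (negbTE ij).
rewrite -[Pr (X i @^-1` A)]/(distribution Pr (X i) A).
rewrite -[Pr (X j @^-1` B)]/(distribution Pr (X j) B) !law// => <-.
congr (_ _); apply/seteqP; split => [w [/= wA wB] k|w h].
  by rewrite /= !inE => /orP[]/eqP->; rewrite ?eqxx// eq_sym (negbTE ij).
split; first by have := h i; rewrite eqxx; apply; rewrite /= !inE eqxx.
have := h j; rewrite eq_sym (negbTE ij); apply.
by rewrite /= !inE eqxx orbT.
Qed.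

(** * The bias correction vanishes *)

(** The worse of the two sides is [x < mu * expR (- e)], since
[1 - expR (- e) <= expR e - 1]. A lower bound [mu0] in place of [mu] makes the
gap uniform over the fitted laws. *)
Lemma ln_gap (R : realType) (e mu0 mu x : R) :
  0 <= e -> 0 < mu0 -> mu0 <= mu -> 0 < x -> e < `|ln mu - ln x| ->
  mu0 * (1 - expR (- e)) < `|x - mu|.
Proof.
move=> e0 mu00 mu0mu x0.
have mu_gt0 : 0 < mu by exact: lt_le_trans mu0mu.
have q0 : 0 <= 1 - expR (- e) by rewrite subr_ge0 expR_le1 oppr_le0.
have qe : 1 - expR (- e) <= expR e - 1.
  by have := expR_ge1Dx e; have := expR_ge1Dx (- e); lra.
have H : mu0 * (1 - expR (- e)) <= mu * (1 - expR (- e)).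
  by rewrite ler_wpM2r.
have xE : expR (ln x) = x by rewrite lnK// posrE.
have muE : expR (ln mu) = mu by rewrite lnK// posrE.
rewrite ltr_normr => /orP[] h.
  have : x < mu * expR (- e).
    by rewrite -muE -expRD -xE ltr_expR; lra.
  move=> ?; rewrite distrC; apply: lt_le_trans (ler_norm _).
  by lra.
have : mu * expR e < x.
  by rewrite -muE -expRD -xE ltr_expR; lra.
have H' : mu * (1 - expR (- e)) <= mu * (expR e - 1) by rewrite ler_pM2l.
by move=> ?; apply: lt_le_trans (ler_norm _); lra.
Qed.

(** A difference of risks larger than [eps] moves the sample mean of
[expR (alpha * x)] away from its expectation by more than a constant [t], by
[ln_gap]; Chebyshev's inequality bounds the probability of this by
[M / (N * t ^+ 2)], which is less than 1/2 for large [N]. A median beyond [eps]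
or [- eps] would give this event probability at least 1/2. *)
Lemma bias_correction_small (R : realType) (alpha G C eps : R) :
  0 < alpha -> 0 < G -> 2 < C -> 0 < eps ->
  exists N0 : nat, forall N (Q : probability R R) (m : \bar R),
    (N0 <= N)%N -> (0 < N)%N -> exp_tail alpha G C Q idfun ->
    is_bias_correction alpha N Q m -> ((- eps)%:E <= m <= eps%:E)%E.
Proof.
move=> alpha0 G0 C2 eps0.
have [mu0 [M [mu00 mom]]] := exp_tail_moments alpha0 G0 C2.
have ae0 : 0 < alpha * eps by rewrite mulr_gt0.
pose t := mu0 * (1 - expR (- (alpha * eps))).
have t0 : 0 < t by rewrite mulr_gt0// subr_gt0 expR_lt1 oppr_lt0.
exists (Num.truncn (2 * M / t ^+ 2)).+1 => N Q m N0N N0 tail.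
have N0R : 0 < N%:R :> R by rewrite ltr0n.
have [mu [mu0mu muE ME]] := mom _ _ Q _ (@measurable_id _ R setT) tail.
have mu_gt0 : 0 < mu by exact: lt_le_trans mu0mu.
have NM : M < N%:R * t ^+ 2 * 2^-1.
  have : 2 * M / t ^+ 2 < N%:R.
    by rewrite (lt_le_trans (truncnS_gt _))// ler_nat.
  by rewrite ltr_pdivrMr ?exprn_gt0//; lra.
pose f (x : R) := expR (alpha * x).
have f0 x : 0 <= f x by exact: expR_ge0.
have mf : measurable_fun [set: R] f.
  by apply: (measurableT_comp (@measurable_expR R)); exact: measurable_funM.
pose L := iid_law Q N.
pose S (s : N.-tuple R) := \sum_(i < N) f (draw (0 : R) i s).
have mS : measurable_fun [set: N.-tuple R] S.
  by apply: measurable_sum => i; exact: measurableT_comp.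
have S0 s : 0 < S s.
  rewrite /S; case: (N) N0 s => // k _ s; rewrite big_ord_recl.
  apply: ltr_pwDl; first exact: expR_gt0.
  by apply: sumr_ge0 => i _.
pose E := [set s | N%:R * t < `|S s - N%:R * mu|].
have mSmu : measurable_fun [set: N.-tuple R] (fun s => S s - N%:R * mu).
  exact: measurable_funB.
have mE : measurable E.
  by apply: measurable_ltr_set => //; exact: measurableT_comp.
have LE : (L E < 2^-1%:E)%E.
  have V : (\int[L]_s ((S s - N%:R * mu) ^+ 2)%:E <= (N%:R * M)%:E)%E.
    exact: (sample_sum_variance (pairwise_iid_draw Q (0 : R) N) mf f0 muE ME).
  have c0 : 0 < (N%:R * t) ^+ 2 by rewrite exprn_gt0// mulr_gt0.
  have sq s : E s -> (N%:R * t) ^+ 2 <= (S s - N%:R * mu) ^+ 2.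
    move=> /ltW Es; rewrite -[leRHS]real_normK ?num_real//.
    by rewrite ler_pXn2r ?nnegrE// mulr_ge0// ltW.
  have : (((N%:R * t) ^+ 2)%:E * L E <= (N%:R * M)%:E)%E.
    apply: le_trans V; apply: markov_set => //; first exact: measurable_funX.
      exact: ltW.
    by move=> s; exact: sqr_ge0.
  have Lfin : L E \is a fin_num by exact: fin_num_measure.
  rewrite -(fineK Lfin) -EFinM lee_fin lte_fin => H.
  have : (N%:R * t) ^+ 2 * fine (L E) < (N%:R * t) ^+ 2 * 2^-1.
    apply: le_lt_trans H _.
    rewrite [ltRHS](_ : _ = N%:R * (N%:R * t ^+ 2 * 2^-1)); last by ring.
    by rewrite ltr_pM2l.
  by rewrite ltr_pM2l.
pose D s := alpha^-1 * ln mu - alpha^-1 * ln (S s / N%:R).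
have DE (s : N.-tuple R) : (entropic_risk alpha Q idfun
    - entropic_risk alpha (empirical R N (nth 0%R s : nat -> R)) idfun)%E
    = (D s)%:E.
  rewrite (entropic_risk_fin muE mu_gt0).
  by rewrite (entropic_risk_empirical _ _ (@measurable_id _ R setT) N0).
have mD : measurable_fun [set: N.-tuple R] D.
  apply: measurable_funB => //; apply: measurable_funM => //.
  apply: (measurableT_comp (@measurable_ln R)).
  exact: measurable_funM.
have DS s : eps < `|D s| -> E s.
  move=> h; rewrite /E/=.
  have x0 : 0 < S s / N%:R by rewrite divr_gt0.
  have /(ln_gap (ltW ae0) mu00 mu0mu x0) :
      alpha * eps < `|ln mu - ln (S s / N%:R)|.
    move: h; rewrite /D -mulrBr normrM gtr0_norm ?invr_gt0//.
    by rewrite mulrC ltr_pdivlMr// mulrC.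
  rewrite -/t -(ltr_pM2l N0R) => /lt_le_trans; apply.
  rewrite -[X in X * _ <= _](gtr0_norm N0R) -normrM.
  by rewrite mulrBr mulrC divfK// gt_eqF.
have small (A : set (N.-tuple R)) : measurable A -> (2^-1%:E <= L A)%E ->
    (forall s, A s -> eps < `|D s|) -> False.
  move=> mA LA AD.
  have : (L A <= L E)%E.
    by apply: le_measure; rewrite ?inE// => s /AD; exact: DS.
  by move=> /(le_trans LA); rewrite leNgt LE.
rewrite /is_bias_correction /is_median -/L; under eq_fun do rewrite DE.
under [in X in _ /\ X]eq_set do rewrite DE.
move=> [mle mge].
apply/andP; split; rewrite leNgt; apply/negP => h.
- apply: (small _ _ mle).
    rewrite -[X in measurable X]setTI; apply: emeasurable_fun_infty_c => //.
    exact/measurable_EFinP.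
  move=> s /= /le_lt_trans /(_ h); rewrite lte_fin => ?.
  by rewrite ltr_normr; apply/orP; right; rewrite ltrNr.
- apply: (small _ _ mge).
    rewrite -[X in measurable X]setTI; apply: emeasurable_fun_c_infty => //.
    exact/measurable_EFinP.
  move=> s /= /(lt_le_trans h); rewrite lte_fin => ?.
  by rewrite ltr_normr; apply/orP; left.
Qed.

(** * Consistency of the corrected estimator *)

Lemma cvge0_small (R : realType) (u : nat -> \bar R) :
  (forall e : R, 0 < e ->
    \forall n \near \oo, ((- e)%:E <= u n <= e%:E)%E) ->
  u @ \oo --> 0%E.
Proof.
move=> small.
have fin e n : ((- e)%:E <= u n <= e%:E)%E -> u n \is a fin_num.
  by case: (u n) => [r| |]//=; rewrite ?leye_eq ?leeNy_eq ?andbF.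
apply: cvg_EFin.
  by apply: filterS (small 1 ltr01) => n; exact: fin.
apply/cvgrPdist_le => e e0; apply: filterS (small e e0) => n h.
move: h (fin _ _ h); rewrite /= sub0r normrN ler_norml.
by case: (u n).
Qed.

Theorem theorem9 (R : realType) (alpha : R) (alpha_gt0 : 0 < alpha)
    (d m : nat)
    (* decisions, law of the random vector eta, loss *)
    (Z : set (d.-tuple R)) (P : probability (m.-tuple R) R)
    (l : d.-tuple R -> m.-tuple R -> R)
    (l_meas : forall z, Z z -> measurable_fun [set: m.-tuple R] (l z))
    (* probability space of the sampling process and the fitting procedure *)
    (dO : measure_display) (Omega : measurableType dO)
    (Pr : probability Omega R)
    (etah : nat -> {mfun Omega >-> m.-tuple R})
    (etah_iid : iid_sample Pr P etah)
    (* fitting procedure: may use, besides the loss scenarios, an auxiliary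
       random element U *)
    (dX : measure_display) (Xi : measurableType dX)
    (U : {mfun Omega >-> Xi})
    (fit : forall N : nat, N.-tuple R * Xi -> probability R R)
    (fit_meas : forall (N : nat) (B : set R), measurable B ->
       measurable_fun [set: N.-tuple R * Xi] (fun s => fit N s B))
    (Q : d.-tuple R -> nat -> Omega -> probability R R)
    (Q_def : forall z N w,
       Q z N w = fit N (scenarios N (l z) (fun i => etah i w), U w))
    (delta : d.-tuple R -> nat -> Omega -> \bar R)
    (delta_def : forall z N w, Z z -> (0 < N)%N ->
       is_bias_correction alpha N (Q z N w) (delta z N w))
    (l_tail : forall z, Z z ->
       exists G C : R, [/\ 0 < G, 2 < C & exp_tail alpha G C P (l z)])
    (Q_tail : forall z, Z z ->
       {ae Pr, forall w, exists (G C : R) (Nbar : nat),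
         [/\ 0 < G, 2 < C, (0 < Nbar)%N &
          forall N : nat, (Nbar <= N)%N ->
            exp_tail alpha G C (Q z N w) idfun]}) :
  forall z, Z z ->
    {ae Pr, forall w,
      ((fun N : nat =>
          entropic_risk alpha (empirical R N (fun i => etah i w)) (l z)
          + delta z N w)%E @ \oo
        --> entropic_risk alpha P (l z))}.
Proof.
move=> z Zz.
have lz := l_meas z Zz.
have [G [C [G0 C2 tail]]] := l_tail z Zz.
have [mu0 [M [mu00 mom]]] := exp_tail_moments alpha_gt0 G0 C2.
have [mu [mu0mu muE ME]] := mom _ _ P _ lz tail.
have mu_gt0 : 0 < mu by exact: lt_le_trans mu0mu.
pose f x := expR (alpha * l z x).
have mf : measurable_fun [set: m.-tuple R] f.
  by apply: (measurableT_comp (@measurable_expR R)); exact: measurable_funM.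
have f0 x : 0 <= f x by exact: expR_ge0.
have slln := strong_law (fun N => pairwise_iid_sample N etah_iid) mf f0 muE ME.
apply: filterS2 slln (Q_tail z Zz) =>
  w mean_cvg [G' [C' [Nbar [G'0 C'2 Nbar0 Qtail]]]].
rewrite (entropic_risk_fin muE mu_gt0) -[X in _ --> X]adde0.
apply: cvgeD; first by rewrite fin_num_adde_defl.
  apply: (@cvg_trans _ ((fun N : nat => (alpha^-1 *
      ln ((\sum_(i < N) f (etah i w)) / N%:R))%:E) @ \oo)).
    apply: near_eq_cvg; exists 1%N => // N /= N0.
    by rewrite (entropic_risk_empirical _ _ lz N0).
  apply: cvg_EFin; first exact: nearW.
  apply: cvgMr; apply: (cvg_comp _ _ mean_cvg); exact: continuous_ln.
apply: cvge0_small => e e0.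
have [N0 small] := bias_correction_small alpha_gt0 G'0 C'2 e0.
exists (maxn N0 Nbar) => // N /=; rewrite geq_max => /andP[N0N NbarN].
have N_gt0 : (0 < N)%N by exact: leq_trans NbarN.
by apply: (small N (Q z N w)) => //; [exact: Qtail|exact: delta_def].
Qed.
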